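(* Consider the minimax quickest change detection problem of minimizing $\mathrm{WADD}(n')$ over alarm times $n'$ subject to $\mathbb{E}_\infty(n')\ge\gamma$, for $M$ sensors whose observations follow, before and after the change time $\tau$, distributions $f_0$ and $f_1$ that both satisfy the pairwise Markov property with respect to a common decomposable undirected graph with $K$ cliques. Let $s$ be a distance measure between $f_0$ and $f_1$ such that, for all $k=1,\dots,K$ and all $n<\tau$, $\Pr(L_k(X_{n,\mathcal C_k})<0)\to1$ as $s\to\infty$. Then, for sufficiently large $s$, the total number of transmissions saved by the ordered-CUSUM algorithm over the optimum centralized communication-unconstrained approach increases at least as fast as proportionally to $K$, while the detection delay is not affected (it is equal to that of the optimum centralized approach). In particular, for sufficiently large $s$, the total number of transmissions saved is bounded below by $$\left(\left\lceil \frac K2\right\rceil-1\right)(\tau-1).$$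
   Context: **Model.** There are $M$ sensors and a fusion center (FC). At time slot $n\ge1$ the observation vector is $X_{n,[1,M]}=(X_{n,1},\dots,X_{n,M})$. The vectors are independent across $n$ (entries may be dependent across sensors). The change time $\tau$ is a deterministic unknown positive integer; $X_{n,[1,M]}$ has known pdf $f_0$ for $n<\tau$ and known pdf $f_1$ for $n\ge\tau$. $f_0$ and $f_1$ also denote the corresponding marginal pdfs of subvectors. The pair $(f_0,f_1)$ ranges over a family on which a real-valued distance measure $s$ between $f_0$ and $f_1$ is given. $\mathbb{E}_\tau$ is expectation when the change occurs at $\tau$, and $\mathbb{E}_\infty$ when it never occurs. For an alarm time $n'$, $\mathrm{WADD}(n')=\sup_{\tau\ge1}\operatorname{ess\,sup}\mathbb{E}_\tau[(n'-\tau)^+\mid \mathcal I_{\tau-1}]$, where $\mathcal I_{\tau-1}$ consists of all observations of all sensors at time slots $1,\dots,\tau-1$, and $(x)^+=\max\{x,0\}$; this is the measure of detection delay. **Graph.** Under both $f_0$ and $f_1$, $X_{n,[1,M]}$ satisfies the pairwise Markov property with respect to a fixed decomposable undirected graph $\mathcal G=(\mathcal V,\mathcal E)$, $\mathcal V=\{1,\dots,M\}$: for $(m,m')\notin\mathcal E$, $X_{n,m}$ and $X_{n,m'}$ are conditionally independent given the remaining entries. Decomposable means every cycle of length larger than 3 has a chord. Let $\mathcal C_1,\dots,\mathcal C_K$ be a perfect sequence of the (maximal) cliques of $\mathcal G$: with $\mathcal H_k=\mathcal C_1\cup\dots\cup\mathcal C_k$ and separators $\mathcal S_k=\mathcal H_{k-1}\cap\mathcal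 C_k$ ($k=2,\dots,K$), each $\mathcal S_k$ induces a fully connected subgraph and is contained in some $\mathcal C_j$ with $j<k$. Then for $f\in\{f_0,f_1\}$, $f(X_{n,[1,M]})=\prod_{k=1}^K f(X_{n,\mathcal C_k})/\prod_{k=2}^K f(X_{n,\mathcal S_k})$, where $X_{n,A}$ is the subvector indexed by $A$. **Clique statistics.** Let $q(k)=\min\{j:\mathcal S_k\subseteq\mathcal C_j\}$ for $k=2,\dots,K$ and $\mathcal Q_j=\{k: q(k)=j\}$. Fix nonnegative pairs $(\alpha_k,\beta_k)$, $k=2,\dots,K$, with $\alpha_k+\beta_k=1$. Put $\ell(X_{n,A})=\log\frac{f_1(X_{n,A})}{f_0(X_{n,A})}$ and $$L_1(X_{n,\mathcal C_1})=\ell(X_{n,\mathcal C_1})-\sum_{k\in\mathcal Q_1}\beta_k\,\ell(X_{n,\mathcal S_k}),$$ $$L_j(X_{n,\mathcal C_j})=\ell(X_{n,\mathcal C_j})-\alpha_j\,\ell(X_{n,\mathcal S_j})-\sum_{k\in\mathcal Q_j}\beta_k\,\ell(X_{n,\mathcal S_k}),\quad j=2,\dots,K.$$ **Optimum centralized communication-unconstrained approach (CUSUM with threshold $b>0$).** It raises the alarm at $n'=\inf\{n\ge1: GLR_n\ge b\}$, where $GLR_n=\max\{0,\max_{1\le m\le n}\sum_{i=m}^n\log\frac{f_1(X_{i,[1,M]})}{f_0(X_{i,[1,M]})}\}$; all $K$ clique statistics are transmitted to the FC in every time slot. **Ordered-CUSUM (same threshold $b$).** Set $W_0=0$. At time slot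 $n$, order the clique statistics $L_k(X_{n,\mathcal C_k})$, $k=1,\dots,K$, by decreasing absolute value as $|\hat L_{n,1}|\ge|\hat L_{n,2}|\ge\dots\ge|\hat L_{n,K}|$ (ties broken arbitrarily). The cliques transmit to the FC one at a time in this order. After the $j$-th transmission the FC computes $W_{n,j}=W_{n-1}+\sum_{k=1}^j\hat L_{n,k}$; if $W_{n,j}\le-(K-j)|\hat L_{n,j}|$, all further transmissions in slot $n$ are halted and the FC sets $W_n=0$. If this does not happen for any $j\le K$, the FC sets $W_n=W_{n,K}$. If $W_n\ge b$ the alarm is raised at $n'=n$; otherwise the algorithm proceeds to slot $n+1$. **Savings.** Let $k_n^*$ be the number of clique-to-FC transmissions made by ordered-CUSUM in slot $n$. The number of transmissions saved in slot $n$ is $K-k_n^*$, and the total number of transmissions saved is understood on average, i.e. as the expectation of the sum of $K-k_n^*$ over the time slots of the run. Only clique-to-FC transmissions are counted; communication within a clique is free.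
   Formalization: For odd K≥3 the explicit lower bound can fail at every large s (e.g. three independent Gaussian sensors, τ=3), so it is stated up to any ε>0 there; it is exact for even K and K=1. Proportional growth is stated for K≥2, as nothing can be saved when K=1. *)

(* Defs.v *)
From HB Require Import structures.
From mathcomp Require Import all_boot all_order all_algebra all_fingroup.
From mathcomp Require Import all_classical all_reals all_analysis.
From mathcomp Require Import measurable_realfun ess_sup_inf.

Set Implicit Arguments.
Unset Strict Implicit.
Unset Printing Implicit Defensive.

Import Order.TTheory GRing.Theory Num.Theory.
Import numFieldNormedType.Exports.

Local Open Scope ring_scope.

Section Graph.
Variables (M : nat) (e : rel 'I_M).
Implicit Type A : {set 'I_M}.

Definition simple_graph : Prop := symmetric e /\ irreflexive e.

Definition has_chord (c : seq 'I_M) : Prop :=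
  exists x y, [/\ x \in c, y \in c, e x y, y != next c x & x != next c y].

Definition decomposable : Prop :=
  forall c : seq 'I_M, ucycle e c -> (3 < size c)%N -> has_chord c.

Definition complete A : bool :=
  [forall x in A, forall y in A, (x != y) ==> e x y].

Definition maximal_clique A : bool := maxset complete A.

Variables (K : nat) (C : 'I_K -> {set 'I_M}).

(* The cliques C_1, ..., C_K are C 0, ..., C (K-1): indices are shifted by one,
   and separators are meaningful at indices 0 < k (separator 0 is empty). *)
Definition separator (k : 'I_K) : {set 'I_M} :=
  (\bigcup_(j : 'I_K | (j < k)%N) C j) :&: C k.

Definition perfect_clique_sequence : Prop :=
  [/\ injective C,
      forall A, maximal_clique A <-> exists k, C k = A
    & forall k : 'I_K, (0 < k)%N ->
        complete (separator k) /\
        exists2 j : 'I_K, (j < k)%N & separator k \subset C j].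

(* The minimum is over a nonempty set because separator k \subset C k. *)
Definition sep_owner (k : 'I_K) : 'I_K :=
  [arg min_(j < k | separator k \subset C j) (j : nat)].

Definition owned (j : 'I_K) : {set 'I_K} :=
  [set k : 'I_K | (0 < k)%N & sep_owner k == j].

End Graph.

Section Densities.
Variables (R : realType) (M : nat).
Local Notation vec := (M.-tuple R).
Local Open Scope ereal_scope.

Definition upd (x : vec) (m : 'I_M) (t : R) : vec :=
  [tuple (if i == m then t else tnth x i) | i < M].

(* Iterated Lebesgue integral over the coordinates in A, the other coordinates
   being frozen at those of x.  It is only applied to nonnegative measurable
   functions, for which (Tonelli) the order of integration is irrelevant and
   the case A = {0, ..., M-1} is the Lebesgue integral on R^M. *)
Definition integrate_out (A : {set 'I_M}) (g : vec -> \bar R) : vec -> \bar R :=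
  foldr (fun m h x => \int[lebesgue_measure]_t h (upd x m t)) g (enum A).

Definition lebesgue_integral_RM (g : vec -> \bar R) : \bar R :=
  integrate_out [set: 'I_M] g [tuple 0%R | _ < M].

Definition ae_RM (Q : vec -> Prop) : Prop :=
  exists N : set vec,
    [/\ measurable N, lebesgue_integral_RM (fun x => (\1_N x)%:E) = 0
      & forall x, ~ Q x -> N x].

Definition is_pdf (f : vec -> R) : Prop :=
  [/\ measurable_fun setT f, forall x, (0 <= f x)%R
    & lebesgue_integral_RM (fun x => (f x)%:E) = 1].

(* Marginal pdf of the subvector indexed by A; it depends on x only through
   the coordinates in A. *)
Definition marginal (f : vec -> R) (A : {set 'I_M}) (x : vec) : R :=
  fine (integrate_out (~: A) (fun y => (f y)%:E) x).

Local Open Scope ring_scope.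

(* Pdf of the subvector indexed by A given the subvector indexed by B. *)
Definition cond_pdf (f : vec -> R) (A B : {set 'I_M}) (x : vec) : R :=
  marginal f (A :|: B) x / marginal f B x.

Definition cond_indep (f : vec -> R) (m m' : 'I_M) : Prop :=
  let rest := ~: [set m; m'] in
  ae_RM (fun x => 0 < marginal f rest x ->
    cond_pdf f [set m; m'] rest x =
    cond_pdf f [set m] rest x * cond_pdf f [set m'] rest x).

Definition pairwise_markov (e : rel 'I_M) (f : vec -> R) : Prop :=
  forall m m' : 'I_M, m != m' -> ~~ e m m' -> cond_indep f m m'.

Definition factorizes (K : nat) (C : 'I_K -> {set 'I_M}) (f : vec -> R) : Prop :=
  ae_RM (fun x => f x =
    (\prod_(k < K) marginal f (C k) x) /
    (\prod_(k < K | (0 < k)%N) marginal f (separator C k) x)).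

(* With this, every log-likelihood ratio below is finite almost surely, before
   and after the change. *)
Definition same_support (f0 f1 : vec -> R) : Prop :=
  ae_RM (fun x => 0 < f0 x <-> 0 < f1 x).

Definition llr (f0 f1 : vec -> R) (A : {set 'I_M}) (x : vec) : R :=
  ln (marginal f1 A x / marginal f0 A x).

Definition clique_stat (K : nat) (C : 'I_K -> {set 'I_M}) (alpha beta : 'I_K -> R)
    (f0 f1 : vec -> R) (j : 'I_K) (x : vec) : R :=
  llr f0 f1 (C j) x
  - (if (0 < j)%N then alpha j * llr f0 f1 (separator C j) x else 0)
  - \sum_(k in owned C j) beta k * llr f0 f1 (separator C k) x.

End Densities.

Section Probability.
Context {R : realType} {d : measure_display} {T : measurableType d} {M : nat}.
Local Notation vec := (M.-tuple R).
Local Open Scope classical_set_scope.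
Local Open Scope ereal_scope.
Variable X : nat -> T -> vec.

Definition has_pdf (P : probability T R) (Y : T -> vec) (f : vec -> R) : Prop :=
  forall B : set vec, measurable B ->
    P (Y @^-1` B) = lebesgue_integral_RM (fun x => (f x * \1_B x)%:E).

Definition independent_slots (P : probability T R) : Prop :=
  forall (s : seq nat) (B : nat -> set vec), uniq s ->
    (forall n, n \in s -> (1 <= n)%N) -> (forall n, measurable (B n)) ->
    P (\bigcap_(n in [set` s]) (X n @^-1` B n)) =
    \prod_(n <- s) P (X n @^-1` B n).

(* Change time: Some t for a change at slot t, None if it never occurs. *)
Definition changed (tau : option nat) (n : nat) : bool :=
  if tau is Some t then (t <= n)%N else false.

Definition observation_law (P : probability T R) (f0 f1 : vec -> R)
    (tau : option nat) : Prop :=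
  independent_slots P /\
  forall n, (1 <= n)%N -> has_pdf P (X n) (if changed tau n then f1 else f0).

(* sigma-algebra of the observations at slots 1, ..., t-1 *)
Definition history (t : nat) : set (set T) :=
  <<s [set A | exists n (B : set vec),
         [/\ (1 <= n < t)%N, measurable B & A = X n @^-1` B]] >>.

Definition is_cond_exp (P : probability T R) (G : set (set T))
    (Y Z : T -> \bar R) : Prop :=
  [/\ forall w, 0 <= Z w,
      forall B : set (\bar R), measurable B -> G (Z @^-1` B)
    & forall A, G A -> \int[P]_(w in A) Z w = \int[P]_(w in A) Y w].

(* A version of the conditional expectation of the nonnegative variable Y. *)
Definition cond_exp (P : probability T R) (G : set (set T))
    (Y : T -> \bar R) : T -> \bar R :=
  xget (fun=> 0) [set Z | is_cond_exp P G Y Z].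

(* Alarm times are extended-real valued, +oo meaning that no alarm is raised. *)
Definition WADD (P : nat -> probability T R) (alarm : T -> \bar R) : \bar R :=
  ereal_sup [set ess_sup (P t)
      (cond_exp (P t) (history t) (fun w => maxe (alarm w - t%:R%:E) 0))
    | t in [set t | (1 <= t)%N]].

End Probability.

Section Procedures.
Variable R : realType.

(* ereal_inf of the empty set is +oo *)
Definition first_passage (W : nat -> R) (b : R) : \bar R :=
  ereal_inf [set n%:R%:E | n in [set n | (1 <= n)%N && (b <= W n)]]%classic.

(* l i is the log-likelihood ratio of the whole vector observed at slot i *)
Definition GLR (l : nat -> R) (n : nat) : R :=
  \big[Num.max/0]_(1 <= m < n.+1) \sum_(m <= i < n.+1) l i.

Section Ordered.
Variable K : nat.
Implicit Types (w : R) (Lhat : 'I_K -> R).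

Definition ordering (L : 'I_K -> R) (sigma : {perm 'I_K}) : Prop :=
  forall a b : 'I_K, (a <= b)%N -> `|L (sigma b)| <= `|L (sigma a)|.

(* Halting test after transmission number j.+1, with w the value of the
   statistic at the end of the previous slot. *)
Definition halts w Lhat (j : 'I_K) : bool :=
  w + \sum_(k < K | (k <= j)%N) Lhat k <= - ((K - j.+1)%:R * `|Lhat j|).

Definition slot_update w Lhat : R :=
  if [exists j, halts w Lhat j] then 0 else w + \sum_(k < K) Lhat k.

Definition slot_transmissions w Lhat : nat :=
  if [exists j, halts w Lhat j] then (find (halts w Lhat) (enum 'I_K)).+1
  else K.

Variable Lhat : nat -> 'I_K -> R.

Fixpoint ordered_W (n : nat) : R :=
  if n is n'.+1 then slot_update (ordered_W n') (Lhat n) else 0.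

Definition transmissions (n : nat) : nat :=
  slot_transmissions (ordered_W n.-1) (Lhat n).

Definition total_saved (b : R) : \bar R :=
  (\sum_(1 <= n <oo)
     (if n%:R%:E <= first_passage ordered_W b
      then (K - transmissions n)%:R%:E else 0))%E.

End Ordered.
End Procedures.

Definition for_large (R : realType) (I : Type) (s : I -> R) (Q : I -> Prop) : Prop :=
  exists s0 : R, forall i, s0 <= s i -> Q i.

(* Main.v *)
(* Both alarm statistics obey the recursion W_n = max(0, W_(n-1) + y_n): for the
   CUSUM, y_n is the log-likelihood ratio of the whole observation; for
   ordered-CUSUM, it is the sum of all clique statistics, since the order bounds
   every untransmitted statistic by the last transmitted one, so that a slot is
   halted only if the sum would be reset to 0 anyway.  The two increments agree
   almost surely by the factorization over cliques, hence so do the alarm times.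
   If all clique statistics are negative before the change, W stays at 0 and at
   most ceil(K/2) transmissions are made in each of these slots; by the union
   bound this happens with probability close to 1 for large s. *)

Require Import Defs.
From HB Require Import structures.
From mathcomp Require Import all_boot all_order all_algebra all_fingroup.
From mathcomp Require Import all_classical all_reals all_analysis.
From mathcomp Require Import zify ring lra.
From mathcomp Require Import measurable_realfun ess_sup_inf.

Set Implicit Arguments.
Unset Strict Implicit.
Unset Printing Implicit Defensive.

Import Order.TTheory GRing.Theory Num.Theory.
Import numFieldNormedType.Exports.

Local Open Scope ring_scope.

(** * Reflected random walk form of the CUSUM statistic *)

Section Recursion.
Variable R : realType.
Implicit Types (y : nat -> R) (n : nat).

Fixpoint lindley y n : R :=
  if n is n'.+1 then Num.max 0 (lindley y n' + y n) else 0.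

Lemma lindley_ge0 y n : 0 <= lindley y n.
Proof. by case: n => //= n; rewrite le_max lexx. Qed.

Lemma eq_lindley y z n : (forall m, (1 <= m)%N -> y m = z m) ->
  lindley y n = lindley z n.
Proof. by move=> yz; elim: n => //= n ->; rewrite yz. Qed.

(** One slot of the CUSUM recursion: a new observation adds the same increment [a] to the sum from
    every earlier starting point, while the newest starting point [m] had an empty sum so far. *)
Lemma bigmax_rcons_add (r : seq nat) (m : nat) (F : nat -> R) (a : R) :
  F m = 0 ->
  \big[Num.max/0]_(i <- rcons r m) (F i + a) =
  Num.max 0 (\big[Num.max/0]_(i <- r) F i + a).
Proof.
move=> Fm; elim: r => [|i r ih] /=.
  by rewrite big_cons !big_nil Fm !add0r maxC.
by rewrite !big_cons ih maxCA addr_maxl.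
Qed.

Lemma GLR_lindley y n : GLR y n = lindley y n.
Proof.
elim: n => [|n ih]; first by rewrite /GLR big_geq.
rewrite /= -ih /GLR.
have -> : index_iota 1 n.+2 = rcons (index_iota 1 n.+1) n.+1.
  by rewrite /index_iota !subSS !subn0 -cats1 -[n.+1 in LHS]addn1 iotaD add1n.
rewrite -(@bigmax_rcons_add _ n.+1 (fun m => \sum_(m <= i < n.+1) y i)) ?big_geq //.
apply: eq_big_seq => m; rewrite mem_rcons inE mem_index_iota => mn.
rewrite big_nat_recr //=.
by case/orP: mn => [/eqP ->|/andP[_ /ltnW]].
Qed.

End Recursion.

(** * The halting rule within one slot *)

Section Slot.
Variables (R : realType) (K : nat).
Implicit Types (w : R) (L : 'I_K -> R) (sigma : {perm 'I_K}).

Lemma card_ord_le (j : 'I_K) : #|[pred k : 'I_K | (k <= j)%N]| = j.+1.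
Proof.
rewrite -sum1_card (eq_bigl (fun k : 'I_K => (k < j.+1)%N)) //.
by rewrite -(big_ord_widen _ (fun=> 1%N)) // sum1_card card_ord.
Qed.

Lemma card_ord_gt (j : 'I_K) : #|[pred k : 'I_K | (j < k)%N]| = (K - j.+1)%N.
Proof.
have := cardC [pred k : 'I_K | (k <= j)%N].
rewrite card_ord card_ord_le => /(congr1 (subn^~ j.+1)) /=; rewrite addKn => <-.
by apply: eq_card => k; rewrite !inE -ltnNge.
Qed.

(* The untransmitted statistics sum to at most (K-j)|L_j|, so halting
   certifies that the CUSUM update would be reset to 0 anyway. *)
Lemma slot_update_max w L sigma : 0 <= w -> ordering L sigma ->
  slot_update w (fun j => L (sigma j)) = Num.max 0 (w + \sum_k L k).
Proof.
move=> w0 ord; rewrite /slot_update [in RHS](reindex_inj (@perm_inj _ sigma)) /=.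
case: ifPn => [/existsP[j]|/existsPn nh].
  rewrite /halts => hj; apply/esym/max_idPl.
  rewrite (bigID (fun k : 'I_K => (k <= j)%N)) /= addrA.
  rewrite -[leRHS](addNr ((K - j.+1)%:R * `|L (sigma j)|)) lerD //.
  under eq_bigl => k do rewrite -ltnNge.
  rewrite mulr_natl -card_ord_gt -sumr_const; apply: ler_sum => k jk.
  exact: le_trans (ler_norm _) (ord _ _ (ltnW jk)).
apply/esym/max_idPr.
case: K L sigma ord nh => [|K'] L' sigma' ord' nh'.
  by rewrite big_ord0 addr0.
(* After the last transmission nothing is outstanding, so failure of this test means that the full
   sum is positive. *)
have := nh' ord_max; rewrite /halts /= subnn mul0r oppr0 -ltNge => /ltW.
by under eq_bigl => k do rewrite leq_ord.
Qed.

(** The first [j.+1] statistics are negative and at least as large in absolute value as the last of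
    them, so they sum to at most [- j.+1 * |L (sigma j)|]; at most [j.+1] statistics remain. *)
Lemma halts_neg L sigma (j : 'I_K) : ordering L sigma ->
  (forall k, L k < 0) -> (K <= j.+1.*2)%N ->
  halts 0 (fun j => L (sigma j)) j.
Proof.
move=> ord L0 Kj; rewrite /halts add0r lerNr -sumrN.
apply: (@le_trans _ _ (j.+1%:R * `|L (sigma j)|)).
  by rewrite ler_wpM2r // ler_nat leq_subLR addnn.
rewrite mulr_natl -card_ord_le -sumr_const; apply: ler_sum => k kj.
by rewrite -(ltr0_norm (L0 _)) ord.
Qed.

Lemma slot_transmissions_neg L sigma : ordering L sigma ->
  (forall k, L k < 0) ->
  (K./2 <= K - slot_transmissions 0 (fun j => L (sigma j)))%N.
Proof.
move=> ord L0; have [K0|K0] := leqP K 0; first by rewrite (leq_trans (half_leq K0)).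
(* Zero-based index of transmission number ceil(K/2), the first index to which [halts_neg] applies;
   halting there or earlier leaves at least floor(K/2) transmissions unsent. *)
have jK : ((uphalf K).-1 < K)%N by rewrite uphalfE; lia.
pose j := Ordinal jK.
have hj : halts 0 (fun j => L (sigma j)) j.
  by apply: halts_neg => //=; rewrite uphalfE; lia.
rewrite /slot_transmissions; case: ifPn => [_|/existsPn/(_ j)/negP//].
have : (find (halts 0 (fun j => L (sigma j))) (enum 'I_K) <= j)%N.
  rewrite leqNgt; apply/negP => /(before_find j).
  by rewrite nth_ord_enum hj.
by rewrite /= uphalfE; lia.
Qed.

End Slot.

(** * Whole runs of ordered-CUSUM *)

Section Run.
Variables (R : realType) (K : nat) (L : nat -> 'I_K -> R).
Variables (sigma : nat -> {perm 'I_K}) (b : R).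
Hypothesis ord : forall n, (1 <= n)%N -> ordering (L n) (sigma n).
Hypothesis b0 : 0 < b.

Let Lhat n j := L n (sigma n j).

Lemma ordered_W_lindley n :
  ordered_W Lhat n = lindley (fun n => \sum_k L n k) n.
Proof.
by elim: n => //= n ->; rewrite slot_update_max ?lindley_ge0 //; exact: ord.
Qed.

Lemma ordered_W_neg (N n : nat) :
  (forall m k, (1 <= m <= N)%N -> L m k < 0) -> (n <= N)%N ->
  ordered_W Lhat n = 0.
Proof.
move=> L0; rewrite ordered_W_lindley; elim: n => //= n ih nN.
rewrite ih ?add0r; last exact: ltnW.
by apply/max_idPl; apply: sumr_le0 => k _; apply/ltW/L0.
Qed.

Lemma total_saved_neg (tau : nat) : (1 <= tau)%N ->
  (forall n k, (1 <= n < tau)%N -> L n k < 0) ->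
  ((K./2 * (tau - 1))%:R%:E <= total_saved Lhat b)%E.
Proof.
move=> tau1 L0.
have L0' m k : (1 <= m <= tau.-1)%N -> L m k < 0.
  by move=> mt; apply: L0; lia.
(* All terms are nonnegative, so the series dominates its partial sum over the slots before
   [tau]. *)
apply: le_trans (nneseries_lim_ge tau _) => [|n _ _]; last first.
  by case: ifP => // _; rewrite lee_fin.
rewrite (eq_big_seq
  (fun n => (K - transmissions Lhat n)%:R%:E)) => [|n]; last first.
  rewrite mem_index_iota => /andP[n1 nt]; rewrite ifT //.
  (* These slots all count: the statistic is 0 < [b] throughout them, so no alarm precedes slot
     [n]. *)
  apply: le_ereal_inf_tmp => _ [m /andP[m1 bm] <-]; rewrite lee_fin ler_nat.
  rewrite leqNgt; apply/negP => mn; move: bm.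
  by rewrite (ordered_W_neg L0') ?leNgt ?b0 //; lia.
rewrite sumEFin lee_fin -natr_sum ler_nat mulnC.
rewrite -sum_nat_const_nat.
rewrite [X in (X <= _)%N]big_seq [X in (_ <= X)%N]big_seq; apply: leq_sum => n.
rewrite mem_index_iota => n1t.
rewrite /transmissions (ordered_W_neg L0'); last by lia.
by apply: slot_transmissions_neg => [|k]; [apply: ord; lia|exact: L0].
Qed.

End Run.

(** * Iterated integrals and measurability of the statistics *)

Section Tuples.
Variables (R : realType) (M : nat).
Local Notation vec := (M.-tuple R).
Local Open Scope ereal_scope.

(** Joint measurability in the vector and the new coordinate is what lets Tonelli's theorem act on
    one coordinate at a time. *)
Lemma measurable_upd (m : 'I_M) :
  measurable_fun setT (fun p : vec * R => upd p.1 m p.2).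
Proof.
apply/measurable_fun_tnthP => i.
have [im|im] := eqVneq i m.
  apply: eq_measurable_fun measurable_snd => p _ /=.
  by rewrite tnth_mktuple im eqxx.
apply: eq_measurable_fun (measurableT_comp (measurable_tnth i) measurable_fst).
by move=> p _ /=; rewrite tnth_mktuple (negbTE im).
Qed.

(** [integrate_out] over an arbitrary list in place of [enum A], to allow induction on the list. *)
Definition iterated (r : seq 'I_M) (g : vec -> \bar R) : vec -> \bar R :=
  foldr (fun m h x => \int[lebesgue_measure]_t h (upd x m t)) g r.

Lemma iterated_ge0 (r : seq 'I_M) (g : vec -> \bar R) :
  (forall x, 0 <= g x) -> forall x, 0 <= iterated r g x.
Proof. by move=> g0; elim: r => //= m r ih x; apply: integral_ge0. Qed.

Lemma measurable_iterated (r : seq 'I_M) (g : vec -> \bar R) :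
  (forall x, 0 <= g x) -> measurable_fun setT g ->
  measurable_fun setT (iterated r g).
Proof.
move=> g0 mg; elim: r => //= m r ih.
apply: (@measurable_fun_fubini_tonelli_F _ _ _ _ _ lebesgue_measure
  (fun p : vec * R => iterated r g (upd p.1 m p.2))).
  exact: measurableT_comp ih (measurable_upd m).
by move=> p; apply: iterated_ge0.
Qed.

Lemma measurable_iterated_upd (r : seq 'I_M) (g : vec -> \bar R) m (x : vec) :
  (forall x, 0 <= g x) -> measurable_fun setT g ->
  measurable_fun setT (fun t => iterated r g (upd x m t)).
Proof.
move=> g0 mg; apply: measurableT_comp (measurable_iterated r g0 mg) _.
exact: (measurableT_comp (measurable_upd m) (pair1_measurable x)).
Qed.

(** Transfers Lebesgue-null sets to a law with a density. A vanishing outer integral of a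
    nonnegative function makes the inner integral vanish for almost every value of the outer
    coordinate, where the induction hypothesis applies. *)
Lemma iterated_null (r : seq 'I_M) (g h : vec -> \bar R) :
  (forall x, 0 <= g x) -> measurable_fun setT g ->
  (forall x, 0 <= h x) -> measurable_fun setT h ->
  (forall x, g x = 0 -> h x = 0) ->
  forall x, iterated r g x = 0 -> iterated r h x = 0.
Proof.
move=> g0 mg h0 mh gh; elim: r => //= m r ih x intg0.
have [aeg _] := ae_eq_integral_abs lebesgue_measure measurableT
  (measurable_iterated_upd r m x g0 mg).
rewrite -[RHS](integral0 lebesgue_measure setT).
apply: ge0_ae_eq_integral => //.
- exact: measurable_iterated_upd.
- by move=> t _; apply: iterated_ge0.
have {}/aeg : \int[lebesgue_measure]_t `|iterated r g (upd x m t)| = 0.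
  by rewrite -[RHS]intg0; apply: eq_integral => t _; rewrite gee0_abs // iterated_ge0.
apply: filterS => t /= H _.
by rewrite ih // H.
Qed.

Lemma iterated0 (r : seq 'I_M) x : iterated r (cst 0) x = 0.
Proof.
elim: r x => //= m r ih x; rewrite -[RHS](integral0 lebesgue_measure setT).
by apply: eq_integral => t _; rewrite ih.
Qed.

Lemma marginal_ge0 (f : vec -> R) A x :
  (forall x, 0 <= f x)%R -> (0 <= marginal f A x)%R.
Proof. by move=> f0; rewrite fine_ge0 // iterated_ge0 // => y; rewrite lee_fin. Qed.

Lemma marginalT (f : vec -> R) x : marginal f [set: 'I_M] x = f x.
Proof. by rewrite /marginal /integrate_out finset.setCT enum_set0. Qed.

Lemma measurable_marginal (f : vec -> R) A : measurable_fun setT f ->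
  (forall x, 0 <= f x)%R -> measurable_fun setT (marginal f A).
Proof.
move=> mf f0; apply: measurableT_comp => //.
apply: measurable_iterated => [x|]; first by rewrite lee_fin.
exact/measurable_EFinP.
Qed.

Lemma measurable_llr (f0 f1 : vec -> R) A : is_pdf f0 -> is_pdf f1 ->
  measurable_fun setT (llr f0 f1 A).
Proof.
move=> [mf0 f0_ge0 _] [mf1 f1_ge0 _]; apply: measurableT_comp => //.
apply: measurable_funM; first exact: measurable_marginal.
(* Inversion agrees with the real power -1 on nonnegative numbers, 0 included, and real powers are
   measurable. *)
apply: (@eq_measurable_fun _ _ _ _ _ (fun x => marginal f0 A x `^ (-1))%R).
  by move=> x _; rewrite powR_inv1 // marginal_ge0.
exact: measurableT_comp (measurable_powR _) (measurable_marginal A mf0 f0_ge0).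
Qed.

Lemma measurable_clique_stat (K : nat) (C : 'I_K -> {set 'I_M})
    (alpha beta : 'I_K -> R) (f0 f1 : vec -> R) j : is_pdf f0 -> is_pdf f1 ->
  measurable_fun setT (clique_stat C alpha beta f0 f1 j).
Proof.
move=> pdf0 pdf1; apply: measurable_funB; first apply: measurable_funB.
- exact: measurable_llr.
- by case: (0 < j)%N; [apply: measurable_funM => //; exact: measurable_llr|].
- under eq_fun do rewrite big_mkcond.
  apply: measurable_sum => k; case: (k \in owned C j) => //.
  by apply: measurable_funM => //; exact: measurable_llr.
Qed.

End Tuples.

(** * The log-likelihood ratio as a sum of clique statistics *)

Section Factorization.
Variables (R : realType) (M : nat).
Local Notation vec := (M.-tuple R).

Lemma ln_prod (I : finType) (p : pred I) (F : I -> R) :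
  (forall i, p i -> 0 < F i) -> ln (\prod_(i | p i) F i) = \sum_(i | p i) ln (F i).
Proof.
(* Positivity of the partial products is carried along, as [lnM] requires it. *)
move=> F0; have [//] : ln (\prod_(i | p i) F i) = \sum_(i | p i) ln (F i) /\
  0 < \prod_(i | p i) F i.
apply: (big_ind2 (fun x y => ln x = y /\ 0 < x)) => [|x _ y _ [<- x0] [<- y0]|i /F0].
- by rewrite ln1.
- by rewrite lnM ?mulr_gt0.
- by split.
Qed.

Lemma prodr_neq0_gt0 (I : finType) (p : pred I) (F : I -> R) :
  (forall i, 0 <= F i) -> \prod_(i | p i) F i != 0 -> forall i, p i -> 0 < F i.
Proof. by move=> F0 /prodf_neq0 Fn i /Fn; rewrite lt0r F0 andbT. Qed.

Variables (K : nat) (C : 'I_K -> {set 'I_M}).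

(* Positivity of the quotient forces every marginal to be nonzero, because
   x / 0 = 0. *)
Lemma ln_factorization (f : vec -> R) x : (forall x, 0 <= f x) -> 0 < f x ->
  f x = (\prod_(k < K) marginal f (C k) x) /
        (\prod_(k < K | (0 < k)%N) marginal f (separator C k) x) ->
  [/\ ln (f x) = \sum_(k < K) ln (marginal f (C k) x) -
        \sum_(k < K | (0 < k)%N) ln (marginal f (separator C k) x),
      forall k, 0 < marginal f (C k) x
    & forall k : 'I_K, (0 < k)%N -> 0 < marginal f (separator C k) x].
Proof.
move=> f0 fx fE; have m0 A : 0 <= marginal f A x by exact: marginal_ge0.
move: (lt0r_neq0 fx); rewrite {1}fE mulf_eq0 invr_eq0 negb_or => /andP[n0 d0].
have Cpos k : 0 < marginal f (C k) x by exact: prodr_neq0_gt0 n0 k _.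
have Spos := prodr_neq0_gt0 (fun k => m0 (separator C k)) d0.
split => //; rewrite fE ln_div ?posrE ?ln_prod //.
  by rewrite lt0r n0 prodr_ge0.
by rewrite lt0r d0 prodr_ge0.
Qed.

(** Separator [k] is subtracted with weight [alpha k] in clique [k] and with weight [beta k] in its
    owner, hence with total weight 1, as in the logarithm of the clique factorization. *)
Lemma sum_clique_stat (alpha beta : 'I_K -> R) (f0 f1 : vec -> R) x :
  (forall k : 'I_K, (0 < k)%N -> alpha k + beta k = 1) ->
  (forall f, f = f0 \/ f = f1 -> [/\ forall x, 0 <= f x, 0 < f x &
    f x = (\prod_(k < K) marginal f (C k) x) /
          (\prod_(k < K | (0 < k)%N) marginal f (separator C k) x)]) ->
  \sum_j clique_stat C alpha beta f0 f1 j x = llr f0 f1 [set: 'I_M] x.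
Proof.
move=> ab H; have [f0_ge0 f0x f0E] := H f0 (or_introl erefl).
have [f1_ge0 f1x f1E] := H f1 (or_intror erefl).
have [ln0 C0 S0] := ln_factorization f0_ge0 f0x f0E.
have [ln1 C1 S1] := ln_factorization f1_ge0 f1x f1E.
rewrite /clique_stat !sumrB -big_mkcond /=.
have -> : \sum_(j < K) \sum_(k in owned C j) beta k * llr f0 f1 (separator C k) x =
    \sum_(k < K | (0 < k)%N) beta k * llr f0 f1 (separator C k) x.
  rewrite [RHS](partition_big (sep_owner C) predT) //=.
  by apply: eq_bigr => j _; apply: eq_bigl => k; rewrite inE.
rewrite -addrA -opprD -big_split /=.
rewrite [X in _ - X](eq_bigr (fun k => ln (marginal f1 (separator C k) x) -
    ln (marginal f0 (separator C k) x))) => [|k k0]; last first.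
  by rewrite -mulrDl ab // mul1r /llr ln_div ?posrE ?S0 ?S1.
rewrite [X in X - _](eq_bigr (fun k => ln (marginal f1 (C k) x) -
    ln (marginal f0 (C k) x))) => [|k _]; last by rewrite /llr ln_div ?posrE.
rewrite /llr !marginalT ln_div ?posrE // ln0 ln1 !sumrB.
by ring.
Qed.

End Factorization.

(** * From Lebesgue-almost everywhere to almost surely *)

Section AlmostSure.
Context {R : realType} {d : measure_display} {T : measurableType d} {M : nat}.
Local Notation vec := (M.-tuple R).
Variables (P : probability T R) (Y : T -> vec) (f : vec -> R).
Hypotheses (mY : measurable_fun setT Y) (pdf : is_pdf f) (Yf : has_pdf P Y f).
Local Open Scope classical_set_scope.

Lemma negligible_preimage (N : set vec) : measurable N ->
  (lebesgue_integral_RM (fun x => (f x * \1_N x)%:E) = 0)%E ->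
  P.-negligible (Y @^-1` N).
Proof.
move=> mN N0; exists (Y @^-1` N); split => //; last by rewrite -N0 Yf.
by rewrite -[X in measurable X]setTI; exact: mY.
Qed.

Lemma ae_RM_negligible (Q : vec -> Prop) : ae_RM Q ->
  P.-negligible [set w | ~ Q (Y w)].
Proof.
have [mf f0 _] := pdf; move=> [N [mN N0 NQ]].
apply: (@negligibleS _ _ _ _ (Y @^-1` N)) => [w /NQ //|].
apply: negligible_preimage => //; move: N0; apply: iterated_null.
- by move=> x; rewrite lee_fin.
- exact/measurable_EFinP/measurable_indic.
- by move=> x; rewrite lee_fin mulr_ge0.
- by apply/measurable_EFinP/measurable_funM => //; exact: measurable_indic.
- by move=> x [->]; rewrite mulr0.
Qed.

(** The density times the indicator of its own zero set is identically 0. *)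
Lemma pdf_eq0_negligible : P.-negligible [set w | f (Y w) = 0].
Proof.
have [mf _ _] := pdf.
apply: (@negligible_preimage [set x | f x = 0]).
  by rewrite -[X in measurable X]setTI; exact: mf (measurable_set1 0).
rewrite [X in lebesgue_integral_RM X](_ : _ = cst 0%E); first exact: iterated0.
apply/funext => x /=; congr _%:E.
rewrite indicE; case: (boolP (x \in _)) => [|_]; last by rewrite mulr0.
by rewrite inE /= => ->; rewrite mul0r.
Qed.

Lemma sum_clique_stat_negligible (K : nat) (C : 'I_K -> {set 'I_M})
    (alpha beta : 'I_K -> R) (f0 f1 : vec -> R) :
  f = f0 \/ f = f1 ->
  (forall k : 'I_K, (0 < k)%N -> alpha k + beta k = 1) ->
  (forall g, g = f0 \/ g = f1 -> is_pdf g /\ factorizes C g) ->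
  same_support f0 f1 ->
  P.-negligible [set w | \sum_j clique_stat C alpha beta f0 f1 j (Y w) !=
                         llr f0 f1 [set: 'I_M] (Y w)].
Proof.
move=> f01 ab H supp.
have [_ fac0] := H f0 (or_introl erefl); have [_ fac1] := H f1 (or_intror erefl).
(* Off these four null events [f] is positive at the observation; being one of [f0] and [f1], which
   share their support, it makes both positive, and both factorize there. *)
have := negligibleU (negligibleU pdf_eq0_negligible (ae_RM_negligible supp))
  (negligibleU (ae_RM_negligible fac0) (ae_RM_negligible fac1)).
apply: negligibleS => w /= neq; apply: contrapT => nU.
have fn0 : f (Y w) != 0 by apply/eqP => fw; apply: nU; left; left.
have [s01 s10] : 0 < f0 (Y w) <-> 0 < f1 (Y w).
  by apply: contrapT => ns; apply: nU; left; right.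
have fac g : g = f0 \/ g = f1 -> g (Y w) = (\prod_(k < K) marginal g (C k) (Y w)) /
    (\prod_(k < K | (0 < k)%N) marginal g (separator C k) (Y w)).
  by case=> ->; apply: contrapT => nE; apply: nU; right; [left|right].
move/negP: neq; apply; apply/eqP; apply: sum_clique_stat => // g g01.
have [[_ g0 _] _] := H g g01.
have fpos : 0 < f (Y w) by have [_ f_ge0 _] := pdf; rewrite lt0r fn0 f_ge0.
split => //; last exact: fac.
by case: f01 g01 fpos => -> [] ->.
Qed.

End AlmostSure.

(** * Alarm times, conditional expectations and worst-case delay *)

Section Alarms.
Context {R : realType} {d : measure_display} {T : measurableType d} {M : nat}.
Local Notation vec := (M.-tuple R).
Local Open Scope classical_set_scope.

(** Replaces an infimum over a random set of slots by one over all slots, with value +oo where there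
    is no crossing, so that measurability can be checked slot by slot. *)
Lemma first_passage_einfs (W : nat -> R) (b : R) : first_passage W b =
  einfs (fun n => if (1 <= n)%N && (b <= W n)%R then n%:R%:E else +oo)%E 0.
Proof.
apply/eqP; rewrite eq_le; apply/andP; split; apply: le_ereal_inf_tmp => _ [n n1 <-].
  by case: ifPn => [nW|_]; [apply: ereal_inf_lbound; exists n|exact: leey].
by apply: ereal_inf_lbound; exists n => //; rewrite n1.
Qed.

Lemma measurable_first_passage (W : nat -> T -> R) (b : R) :
  (forall n, measurable_fun setT (W n)) ->
  measurable_fun setT (fun w => first_passage (W ^~ w) b).
Proof.
move=> mW; under eq_fun do rewrite first_passage_einfs.
apply: (measurable_fun_einfs (f := fun n w =>
  if (1 <= n)%N && (b <= W n w)%R then n%:R%:E else +oo)%E) => n.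
apply: measurable_fun_ifT => //; apply: measurable_and => //.
exact: measurable_fun_ler.
Qed.

Lemma first_passage_ge0 (W : nat -> R) b : (0 <= first_passage W b)%E.
Proof. by apply: le_ereal_inf_tmp => _ [n _ <-]; rewrite lee_fin. Qed.

Lemma measurable_lindley (y : nat -> T -> R) n :
  (forall m, (1 <= m)%N -> measurable_fun setT (y m)) ->
  measurable_fun setT (fun w => lindley (y ^~ w) n).
Proof.
move=> my; elim: n => [|n ih] /=; first exact: measurable_cst.
by apply: measurable_maxr => //; apply: measurable_funD => //; exact: my.
Qed.

Lemma history_measurable (X : nat -> T -> vec) t A :
  (forall n, (1 <= n)%N -> measurable_fun setT (X n)) ->
  history X t A -> measurable A.
Proof.
move=> mX; apply: smallest_sub; first exact: sigma_algebra_measurable.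
move=> _ [n [B [/andP[n1 _] mB ->]]].
by rewrite -[X in measurable X]setTI; exact: mX.
Qed.

(** The equality is exact, not merely almost sure: both variables have the same integrals over
    events of [G], hence the same set of versions, and [xget] depends only on that set. *)
Lemma eq_cond_exp (P : probability T R) (G : set (set T)) (Y Y' : T -> \bar R) :
  G `<=` measurable -> measurable_fun setT Y -> measurable_fun setT Y' ->
  (forall w, 0 <= Y w)%E -> (forall w, 0 <= Y' w)%E ->
  P.-negligible [set w | Y w != Y' w] ->
  cond_exp P G Y = cond_exp P G Y'.
Proof.
move=> Gm mY mY' Y0 Y'0 YY'; rewrite /cond_exp; congr xget.
have intE A : G A -> (\int[P]_(w in A) Y w = \int[P]_(w in A) Y' w)%E.
  move=> GA; apply: ge0_ae_eq_integral => //.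
  - exact: Gm.
  - exact: measurable_funTS.
  - exact: measurable_funTS.
  - by apply: negligibleS YY' => w /= /not_implyP[_ /eqP].
apply/seteqP; split=> Z [Z0 mZ ZE]; split=> // A GA.
  by rewrite ZE // intE.
by rewrite ZE // intE.
Qed.

Lemma eq_WADD (X : nat -> T -> vec) (P : nat -> probability T R)
    (a a' : T -> \bar R) :
  (forall n, (1 <= n)%N -> measurable_fun setT (X n)) ->
  measurable_fun setT a -> measurable_fun setT a' ->
  (forall t, (1 <= t)%N -> (P t).-negligible [set w | a w != a' w]) ->
  WADD X P a = WADD X P a'.
Proof.
move=> mX ma ma' aa'.
have mdelay t (c : T -> \bar R) : measurable_fun setT c ->
    measurable_fun setT (fun w => maxe (c w - t%:R%:E) 0)%E.
  move=> mc; apply: measurable_maxe => //.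
  by apply: emeasurable_funB.
have ceE t : (1 <= t)%N ->
    cond_exp (P t) (history X t) (fun w => maxe (a w - t%:R%:E) 0)%E =
    cond_exp (P t) (history X t) (fun w => maxe (a' w - t%:R%:E) 0)%E.
  move=> t1; apply: eq_cond_exp.
  - by move=> A; exact: history_measurable.
  - exact: mdelay.
  - exact: mdelay.
  - by move=> w; rewrite le_max lexx orbT.
  - by move=> w; rewrite le_max lexx orbT.
  - by apply: negligibleS (aa' t t1) => w /=; apply: contra_neq => ->.
rewrite /WADD; apply: (congr1 (@ereal_sup R)); apply: eq_imagel => t t1.
by rewrite ceE.
Qed.

End Alarms.

(** * Finite unions of conditions and a lower bound on integrals *)

Section Bounds.
Context {R : realType} {d : measure_display} {T : measurableType d}.
Local Open Scope classical_set_scope.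

Lemma for_large_all (I : Type) (s : I -> R) (J : eqType) (r : seq J)
    (Q : J -> I -> Prop) :
  (forall j, j \in r -> for_large s (Q j)) ->
  for_large s (fun i => forall j, j \in r -> Q j i).
Proof.
elim: r => [|j r ih] H; first by exists 0.
have [s1 H1] := H j (mem_head _ _).
have [s2 H2] : for_large s (fun i => forall j, j \in r -> Q j i).
  by apply: ih => j' j'r; apply: H; rewrite inE j'r orbT.
exists (Num.max s1 s2) => i; rewrite ge_max => /andP[si1 si2] j'.
by rewrite inE => /orP[/eqP ->|]; [exact: H1|exact: H2].
Qed.

Variable P : probability T R.

Lemma probability_setI_ge (A B : set T) (x y : R) :
  measurable A -> measurable B -> ((1 - x)%:E <= P A)%E -> ((1 - y)%:E <= P B)%E ->
  ((1 - (x + y))%:E <= P (A `&` B))%E.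
Proof.
move=> mA mB.
have : (P (~` A `|` ~` B) <= P (~` A) + P (~` B))%E.
  by apply: measureU2; exact: measurableC.
rewrite -setCI !probability_setC //; last exact: measurableI.
have mAB := measurableI _ _ mA mB.
rewrite -(fineK (fin_num_measure P _ mA)) -(fineK (fin_num_measure P _ mB)).
rewrite -(fineK (fin_num_measure P _ mAB)) -!EFinB -EFinD !lee_fin.
by lra.
Qed.

Lemma probability_all_ge (J : eqType) (r : seq J) (A : J -> set T) (x : R) :
  (forall j, j \in r -> measurable (A j)) ->
  (forall j, j \in r -> ((1 - x)%:E <= P (A j))%E) ->
  measurable [set w | forall j, j \in r -> A j w] /\
  ((1 - (size r)%:R * x)%:E <= P [set w | forall j, j \in r -> A j w])%E.
Proof.
elim: r => [|j r ih] mA PA.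
  rewrite (_ : mkset _ = setT); last by apply/seteqP; split.
  by split; [exact: measurableT|rewrite probability_setT mul0r subr0].
have [mr Pr] := ih (fun k kr => mA k (mem_behead (s := j :: r) kr))
  (fun k kr => PA k (mem_behead (s := j :: r) kr)).
rewrite (_ : mkset _ = A j `&` [set w | forall j, j \in r -> A j w]); last first.
  apply/seteqP; split=> w /= => [H|[Aj Ar] k].
    by split=> [|k kr]; apply: H; rewrite inE ?eqxx ?kr ?orbT.
  by rewrite inE => /orP[/eqP ->|/Ar].
split; first by apply: measurableI => //; apply: mA; rewrite mem_head.
rewrite /= -natr1 mulrDl mul1r [_ + x]addrC.
by apply: probability_setI_ge => //; [apply: mA|apply: PA]; rewrite mem_head.
Qed.

(* Only the minorant has to be measurable. *)
Lemma integral_ge_indic (f : T -> \bar R) (E : set T) (c : R) :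
  measurable E -> 0 <= c -> (forall w, 0 <= f w)%E ->
  (forall w, E w -> c%:E <= f w)%E -> (c%:E * P E <= \int[P]_w f w)%E.
Proof.
move=> mE c0 f0 cf.
have <- : (\int[P]_w (c%:E * (\1_E w)%:E) = c%:E * P E)%E.
  rewrite ge0_integralZl_EFin //; first by rewrite integral_indic // setIT.
  exact/measurable_EFinP/measurable_indic.
rewrite !ge0_integralTE //; last first.
  by move=> w; rewrite mule_ge0 ?lee_fin.
(* Both integrals are suprema over simple functions, and a simple function below [c] times the
   indicator is also below [f]. *)
apply: ge_ereal_sup => _ [h hE <-]; apply: ereal_sup_ubound; exists h => // w.
apply: le_trans (hE w) _; rewrite indicE; case: (boolP (w \in E)) => [|_].
  by rewrite inE mule1 => /cf.
by rewrite mule0.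
Qed.

End Bounds.

(** * Equal alarms and expected savings for large distance *)

Theorem theorem3 (R : realType) :
  exists2 c : R, 0 < c &
  forall (M : nat) (e : rel 'I_M) (K : nat) (C : 'I_K -> {set 'I_M})
    (alpha beta : 'I_K -> R)
    (* the family of pairs of pdfs, and the distance on it *)
    (I : Type) (f0 f1 : I -> M.-tuple R -> R) (s : I -> R)
    (* observations, under the pair i and the change time tau *)
    (d : measure_display) (T : measurableType d) (X : nat -> T -> M.-tuple R)
    (P : I -> option nat -> probability T R)
    (* false alarm constraint, thresholds, and transmission orders *)
    (gamma : R) (b : I -> R) (sigma : I -> nat -> T -> {perm 'I_K}),
  let l i n w := llr (f0 i) (f1 i) [set: 'I_M] (X n w) in
  let L i n w k := clique_stat C alpha beta (f0 i) (f1 i) k (X n w) in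
  let Lhat i w n j := L i n w (sigma i n w j) in
  let alarm_opt i w := first_passage (GLR (fun n => l i n w)) (b i) in
  let alarm_ord i w := first_passage (ordered_W (Lhat i w)) (b i) in
  let saved i tau :=
    (\int[P i (Some tau)]_w total_saved (Lhat i w) (b i))%E in
  (0 < M)%N ->
  simple_graph e -> decomposable e -> perfect_clique_sequence e C ->
  (forall k : 'I_K, (0 < k)%N ->
     [/\ 0 <= alpha k, 0 <= beta k & alpha k + beta k = 1]) ->
  (forall i f, f = f0 i \/ f = f1 i ->
     [/\ is_pdf f, pairwise_markov e f & factorizes C f]) ->
  (forall i, same_support (f0 i) (f1 i)) ->
  (forall n, (1 <= n)%N -> measurable_fun setT (X n)) ->
  (forall i tau, (if tau is Some t then (1 <= t)%N else true) ->
     observation_law X (P i tau) (f0 i) (f1 i) tau) ->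
  (forall i, 0 < b i) ->
  (forall i, gamma%:E <= \int[P i None]_w alarm_opt i w)%E ->
  (forall i n w, (1 <= n)%N -> ordering (L i n w) (sigma i n w)) ->
  (forall i n p, (1 <= n)%N -> measurable [set w | sigma i n w = p]%classic) ->
  (forall (k : 'I_K) (n tau : nat) (eps : R), (1 <= n < tau)%N -> 0 < eps ->
     for_large s (fun i =>
       ((1 - eps)%:E <= P i (Some tau) [set w | (L i n w k < 0)%R]%classic)%E)) ->
  forall (tau : nat) (eps : R), (1 <= tau)%N -> 0 < eps ->
  let bound : R := ((uphalf K - 1) * (tau - 1))%:R in
  for_large s (fun i =>
    [/\ [/\ WADD X (fun t => P i (Some t)) (alarm_ord i) =
            WADD X (fun t => P i (Some t)) (alarm_opt i)
          & (gamma%:E <= \int[P i None]_w alarm_ord i w)%E],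
        (2 <= K)%N -> ((c * K%:R * (tau - 1)%:R)%:E <= saved i tau)%E,
        (~~ odd K \/ K = 1%N) -> (bound%:E <= saved i tau)%E
      & ((bound - eps)%:E <= saved i tau)%E]).
Proof.
(* For [K >= 2], floor(K/2) is at least K/3, and the expectation keeps at least 3/4 of the savings:
   3/4 * 1/3 = 1/4. *)
exists 4^-1; first by rewrite invr_gt0.
move=> M e K C alpha beta I f0 f1 s d T X P gamma b sigma l L Lhat alarm_opt
  alarm_ord saved _ _ _ _ ab pdfs supp mX law b0 false_alarm ord _ negL
  tau eps tau1 eps0 bound.
have pdf0 i : is_pdf (f0 i) by have [] := pdfs i _ (or_introl erefl).
have pdf1 i : is_pdf (f1 i) by have [] := pdfs i _ (or_intror erefl).
have mL i n k : (1 <= n)%N -> measurable_fun setT (fun w => L i n w k).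
  move=> n1; apply: measurableT_comp (mX n n1).
  exact: measurable_clique_stat.
have ml i n : (1 <= n)%N -> measurable_fun setT (l i n).
  by move=> n1; apply: measurableT_comp (mX n n1); exact: measurable_llr.
have optE i w : alarm_opt i w = first_passage (lindley (l i ^~ w)) (b i).
  by congr first_passage; apply/funext => n; exact: GLR_lindley.
have ordE i w :
    alarm_ord i w = first_passage (lindley (fun n => \sum_k L i n w k)) (b i).
  congr first_passage; apply/funext => n.
  by apply: (@ordered_W_lindley _ _ (fun n => L i n w) (fun n => sigma i n w)) => m /ord.
have mopt i : measurable_fun setT (alarm_opt i).
  rewrite (funext (optE i)); apply: measurable_first_passage => n.
  by apply: measurable_lindley => m; exact: ml.
have mord i : measurable_fun setT (alarm_ord i).
  rewrite (funext (ordE i)).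
  apply: (measurable_first_passage (W := fun n w =>
    lindley (fun n => \sum_k L i n w k) n)) => n.
  apply: (measurable_lindley (y := fun n w => \sum_k L i n w k)) => m m1.
  by apply: measurable_sum => k; exact: mL.
have alarms i t : (if t is Some t' then (1 <= t')%N else true) ->
    (P i t).-negligible [set w | alarm_ord i w != alarm_opt i w]%classic.
  move=> t1; have [_ lawn] := law i t t1.
  (* The alarms agree off a countable union of null events, one per slot; the guard [1 <= n] makes
     the event of slot 0 empty. *)
  have neg n : (P i t).-negligible
      [set w | (1 <= n)%N && (\sum_k L i n w k != l i n w)]%classic.
    case: (posnP n) => [->|n1].
      by apply: negligibleS (negligible_set0 _) => w /=.
    have fX : (if changed t n then f1 i else f0 i) = f0 i \/
        (if changed t n then f1 i else f0 i) = f1 i by case: ifP; [right|left].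
    have [pdfX _ _] := pdfs i _ fX.
    have ab1 (k : 'I_K) : (0 < k)%N -> alpha k + beta k = 1 by move=> /ab[].
    have facX g : g = f0 i \/ g = f1 i -> is_pdf g /\ factorizes C g.
      by move=> /pdfs[].
    exact: (sum_clique_stat_negligible (mX n n1) pdfX (lawn n n1) fX ab1 facX
      (supp i)).
  apply: negligibleS (negligible_bigcup neg) => w /= neq.
  apply: contrapT => nU; move/eqP: neq; apply; rewrite ordE optE.
  congr first_passage; apply/funext => n; apply: eq_lindley => m m1.
  apply/eqP; rewrite -[_ == _]negbK; apply/negP => neq.
  by apply: nU; exists m => //=; rewrite m1.
(* [N] transmissions are saved when all statistics are negative before [tau], and [delta] bounds the
   probability of the contrary. It is at most 1/4 for the linear bound, and [N * delta] is at most 1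
   and [eps] for the two others; [N.+1] avoids division by 0. *)
pose N := (K./2 * (tau - 1))%N.
pose m := Num.min eps 1 / N.+1%:R.
have m0 : 0 < m by rewrite divr_gt0 // lt_min eps0 ltr01.
pose delta := Num.min 4^-1 m.
have delta0 : 0 < delta by rewrite lt_min invr_gt0 ltr0n.
have Ndelta4 : N%:R * delta <= N%:R * 4^-1 by rewrite ler_wpM2l // ge_min lexx.
have Ndelta : N%:R * delta <= Num.min eps 1.
  apply: (@le_trans _ _ (N.+1%:R * m)).
    by rewrite ler_pM ?ler0n ?ler_nat ?(ltW delta0) // ge_min lexx orbT.
  by rewrite mulrC divfK // pnatr_eq0.
have Ndelta_eps : N%:R * delta <= eps by rewrite (le_trans Ndelta) // ge_min lexx.
have Ndelta1 : N%:R * delta <= 1 by rewrite (le_trans Ndelta) // ge_min lexx orbT.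
(* The failure probability [delta] is shared equally among the finitely many pairs of a slot before
   [tau] and a clique. *)
pose r := [seq (n, k) | n <- index_iota 1 tau, k <- enum 'I_K].
have mem_r n k : ((n, k) \in r) = (1 <= n < tau)%N.
  apply/allpairsP/idP => [[[n' k'] /= [n'r _ [-> _]]]|nt].
    by rewrite mem_index_iota in n'r.
  by exists (n, k); rewrite /= mem_index_iota mem_enum.
pose x := delta / (size r).+1%:R.
have x0 : 0 < x by rewrite divr_gt0.
have rx : (size r)%:R * x <= delta.
  apply: (@le_trans _ _ ((size r).+1%:R * x)).
    by rewrite ler_wpM2r ?ler_nat // ltW.
  by rewrite mulrC divfK // pnatr_eq0.
have : for_large s (fun i => forall j, j \in r ->
    ((1 - x)%:E <= P i (Some tau) [set w | (L i j.1 w j.2 < 0)%R]%classic)%E).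
  by apply: for_large_all => -[n k]; rewrite mem_r => nt; exact: negL.
move=> [s0 large]; exists s0 => i si.
have savedE : ((N%:R * (1 - delta))%:E <= saved i tau)%E.
  have mA j : j \in r -> measurable [set w | (L i j.1 w j.2 < 0)%R]%classic.
    case: j => n k; rewrite mem_r => /andP[n1 _].
    rewrite (_ : mkset _ = setT `&` (fun w => L i n w k) @^-1` `]-oo, 0%R[)%classic.
      exact: (mL i n k n1).
    by rewrite setTI; apply/seteqP; split=> w; rewrite /= in_itv.
  have [mE PE] := probability_all_ge mA (large i si).
  apply: (@le_trans _ _ (N%:R%:E * P i (Some tau) [set w | forall j, j \in r ->
      [set w | (L i j.1 w j.2 < 0)%R]%classic w]%classic)%E).
    rewrite EFinM; apply: lee_wpmul2l; first by rewrite lee_fin.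
    by apply: le_trans PE; rewrite lee_fin lerB.
  apply: integral_ge_indic => //.
    by move=> w; apply: nneseries_ge0 => n _ _; case: ifP; rewrite ?lee_fin.
  move=> w Ew; apply: (@total_saved_neg _ _ (fun n => L i n w) (fun n => sigma i n w)) => //.
    by move=> n /ord.
  by move=> n k nt; apply: (Ew (n, k)); rewrite mem_r.
split; first split.
- by apply: eq_WADD => // t t1; exact: alarms.
- rewrite (@ge0_ae_eq_integral _ _ _ _ _ _ (alarm_opt i)) //.
  + exact: false_alarm.
  + by move=> w _; exact: first_passage_ge0.
  + by move=> w _; exact: first_passage_ge0.
  + by apply: negligibleS (alarms i None isT) => w /= /not_implyP[_ /eqP].
- move=> K2; apply: le_trans savedE; rewrite lee_fin.
  have : (K * (tau - 1) <= 3 * N)%N.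
    by rewrite /N mulnA leq_mul2r; apply/orP; right; lia.
  rewrite -(ler_nat R) [X in X <= _]natrM [X in _ <= X]natrM -mulrA mulrBr mulr1.
  by lra.
(* For even positive [K], floor(K/2) exceeds ceil(K/2) - 1 by one, so [N] exceeds the bound by at
   least 1 once [tau > 1], which absorbs [N * delta]. In the remaining cases the bound is 0. *)
- move=> oddK; apply: le_trans savedE; rewrite lee_fin /bound.
  have [->|] : ((uphalf K - 1) * (tau - 1) = 0)%N \/
      ((uphalf K - 1) * (tau - 1) + 1 <= N)%N.
  + have [K0|K0] := posnP (K./2); first by left; case: oddK => [|->//]; lia.
    case: oddK => [oddK|->]; last by left.
    have [->|t0] := posnP (tau - 1); first by left; rewrite muln0.
    right; rewrite /N; have -> : K./2 = (uphalf K - 1 + 1)%N.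
      by rewrite uphalfE; lia.
    by rewrite mulnDl mul1n leq_add2l.
  + by have := ler0n R N; rewrite mulrBr mulr1; lra.
  + by rewrite -(ler_nat R) natrD mulrBr mulr1; lra.
(* For odd [K] the two coefficients coincide and leave no slack, so the loss [N * delta] is charged
   to [eps]. *)
- apply: le_trans savedE; rewrite lee_fin /bound.
  have : ((uphalf K - 1) * (tau - 1) <= N)%N.
    by rewrite /N leq_mul2r; apply/orP; right; rewrite uphalfE; lia.
  by rewrite -(ler_nat R) mulrBr mulr1; lra.
Qed.
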